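(* Let $f=\frac1n\sum_{i=1}^n f_i$. Assume that $f$ satisfies the Polyak-Lojasiewicz (PL) condition with constant $\mu>0$, that is, $$\|\nabla f(x)\|^2\ge 2\mu\,(f(x)-f^* )\quad\text{for all }x\in\mathbb{R}^d,$$ and let $f$ and the $f_i$ be smooth functions (the $f_i$ are not assumed convex), with smoothness constants $L$ and $L_i$ respectively, and $L_{\max}=\max\{L_i\}_{i=1}^n$. Then SGD with $\text{SPS}_{\max}$ with $c>\frac{L_{\max}}{4\mu}$ and $\gamma_b\ge\frac{1}{2cL_{\max}}$ converges as $$\mathbb{E}[f(x^k)-f(x^* )]\le\nu^k\,[f(x^0)-f(x^* )]+\frac{L\sigma^2\gamma_b}{2(1-\nu)\,c},$$ where $\nu=\gamma_b\left(\frac1\alpha-2\mu+\frac{L_{\max}}{2c}\right)\in(0,1]$ and $\alpha=\min\left\{\frac{1}{2cL_{\max}},\gamma_b\right\}$.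
   Context: The problem is to minimize $f(x)=\frac1n\sum_{i=1}^n f_i(x)$ over $x\in\mathbb{R}^d$. The set of minimizers of $f$ is assumed nonempty, $x^*$ is a minimizer and $f^*=f(x^* )$ is the minimum value. For each $i$, $f_i^*:=\inf_x f_i(x)$. It is assumed throughout that the optimal objective difference $\sigma^2:=\mathbb{E}_i[f_i(x^* )-f_i^*]=f(x^* )-\mathbb{E}_i[f_i^*]$ is finite, where $\mathbb{E}_i$ is expectation over $i$ uniform in $\{1,\dots,n\}$. A function is smooth with constant $L$ ($L$-smooth) if its gradient is $L$-Lipschitz. SGD: $x^{k+1}=x^k-\gamma_k\nabla f_i(x^k)$, starting from $x^0$, where at each iteration $k$ the index $i\in\{1,\dots,n\}$ is chosen uniformly at random and $\gamma_k>0$ is the step-size. $\text{SPS}_{\max}$ (bounded stochastic Polyak step-size) with parameters $c>0$ and $\gamma_b>0$: $\gamma_k=\min\left\{\frac{f_i(x^k)-f_i^*}{c\,\|\nabla f_i(x^k)\|^2},\,\gamma_b\right\}$, where $i$ is the index chosen at iteration $k$.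
   Formalization: The condition ν∈(0,1] is assumed rather than concluded, since it does not follow from the conditions on c and γ_b (f(x)=x²/2, c=1, γ_b=10 gives ν=5); at ν=1 the noise term, a division by zero, is read as +∞, or as 0 if Lσ²=0. *)

(* Defs.v *)
From HB Require Import structures.
From mathcomp Require Import all_boot all_order all_algebra.
From mathcomp Require Import all_classical all_reals all_analysis.

Set Implicit Arguments.
Unset Strict Implicit.
Unset Printing Implicit Defensive.

Import Order.TTheory GRing.Theory Num.Theory.
Import numFieldNormedType.Exports.

Local Open Scope classical_set_scope.
Local Open Scope ring_scope.

(* The norm carried by the library on 'rV[R]_d is the sup norm, hence an
   explicit Euclidean norm. *)
Definition enorm (R : realType) (d : nat) (v : 'rV[R]_d) : R :=
  Num.sqrt (\sum_(j < d) v 0 j ^+ 2).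

Definition grad (R : realType) (d : nat) (g : 'rV[R]_d -> R) (x : 'rV[R]_d) :
    'rV[R]_d :=
  \row_(j < d) 'D_(delta_mx 0 j) g x.

Definition smooth_with (R : realType) (d : nat) (L : R) (g : 'rV[R]_d -> R) :
    Prop :=
  (forall x, differentiable g x) /\
  (forall x y, enorm (grad g x - grad g y) <= L * enorm (x - y)).

Definition favg (R : realType) (d n : nat) (f : 'I_n -> 'rV[R]_d -> R)
    (x : 'rV[R]_d) : R :=
  n%:R^-1 * \sum_(i < n) f i x.

(* inf_x g(x), which is -oo when g is not bounded below. *)
Definition einf (R : realType) (d : nat) (g : 'rV[R]_d -> R) : \bar R :=
  ereal_inf (range (fun x => (g x)%:E)).

(* Finite exactly when every f i is bounded below. *)
Definition sigma2 (R : realType) (d n : nat) (f : 'I_n -> 'rV[R]_d -> R)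
    (xs : 'rV[R]_d) : \bar R :=
  ((n%:R^-1)%:E * \sum_(i < n) ((f i xs)%:E - einf (f i)))%E.

Definition PL (R : realType) (d : nat) (mu : R) (g : 'rV[R]_d -> R)
    (xs : 'rV[R]_d) : Prop :=
  forall x, enorm (grad g x) ^+ 2 >= 2 * mu * (g x - g xs).

(* Where the gradient vanishes the Polyak quotient is +oo (or 0/0) and the
   step-size is capped at gb; the SGD update does not depend on this value. *)
Definition sps_max (R : realType) (d : nat) (c gb : R) (g : 'rV[R]_d -> R)
    (x : 'rV[R]_d) : R :=
  if grad g x == 0 then gb
  else Num.min ((g x - fine (einf g)) / (c * enorm (grad g x) ^+ 2)) gb.

(* idx k is the index drawn at iteration k. *)
Fixpoint sgd (R : realType) (d n : nat) (f : 'I_n -> 'rV[R]_d -> R)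
    (c gb : R) (x0 : 'rV[R]_d) (idx : nat -> 'I_n) (k : nat) : 'rV[R]_d :=
  if k is k'.+1 then
    let x := sgd f c gb x0 idx k' in
    let g := f (idx k') in
    x - sps_max c gb g x *: grad g x
  else x0.

Definition uniform_index (disp : measure_display) (T : measurableType disp)
    (R : realType) (P : probability T R) (n : nat) (X : T -> 'I_n) : Prop :=
  forall i : 'I_n,
    measurable (X @^-1` [set i]) /\ P (X @^-1` [set i]) = (n%:R^-1)%:E.

Definition mutually_independent (disp : measure_display)
    (T : measurableType disp) (R : realType) (P : probability T R) (n : nat)
    (X : nat -> T -> 'I_n) : Prop :=
  forall (s : seq nat) (A : nat -> set 'I_n), uniq s ->
    P (\bigcap_(k in [set` s]) (X k @^-1` A k)) =
    (\prod_(k <- s) P (X k @^-1` A k))%E.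

(* Main.v *)
(* Smoothness of the average objective F gives
     F(x - g v) <= F(x) - g <grad F(x), v> + K g^2 |v|^2 / 2,
   where v is the gradient of the sampled f_i at x and g is the step-size.  Dividing
   by g and using g |v|^2 <= (f_i(x) - inf f_i) / c and alpha <= g <= gamma_b gives a
   bound whose average over i turns <grad F(x), v> into |grad F(x)|^2; the PL
   inequality then yields the recursion D -> nu D + gamma_b K sigma^2 / (2 c)
   for the mean optimality gap D.

   The constant K is min(L, Lmax): K <= Lmax produces nu, and K <= L produces the
   noise term.  Averaging the descent inequalities of the f_i shows that Lmax is
   admissible for F, whatever L is.

   By independence and uniformity, the expectation at step k is the plain average
   over the n^k index paths of length k, on which the recursion is elementary.

   A negative L forces the space to be a point, where sigma^2 = 0.  When nu = 1 the
   noise term is divided by 0 in the extended reals: it is +oo, unless L sigma^2 = 0,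
   in which case it is 0. *)
Require Import Defs.
From HB Require Import structures.
From mathcomp Require Import all_boot all_order all_algebra.
From mathcomp Require Import all_classical all_reals all_analysis.
From mathcomp Require Import ring lra.

Set Implicit Arguments.
Unset Strict Implicit.
Unset Printing Implicit Defensive.

Import Order.TTheory GRing.Theory Num.Theory.
Import numFieldNormedType.Exports.

Local Open Scope classical_set_scope.
Local Open Scope ring_scope.

(** * Euclidean inner product and norm *)

Definition edot (R : realType) (d : nat) (u v : 'rV[R]_d) : R :=
  \sum_(j < d) u 0 j * v 0 j.

Section Euclidean.
Variables (R : realType) (d : nat).
Implicit Types (u v w : 'rV[R]_d) (a : R).

Lemma edotC u v : edot u v = edot v u.
Proof. by apply: eq_bigr => j _; rewrite mulrC. Qed.

Lemma edotBl u v w : edot (u - v) w = edot u w - edot v w.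
Proof.
by rewrite /edot -sumrB; apply: eq_bigr => j _; rewrite !mxE mulrBl.
Qed.

Lemma edotZr u a v : edot u (a *: v) = a * edot u v.
Proof.
by rewrite /edot mulr_sumr; apply: eq_bigr => j _; rewrite !mxE mulrCA.
Qed.

Lemma edotNr u v : edot u (- v) = - edot u v.
Proof. by rewrite -scaleN1r edotZr mulN1r. Qed.

Lemma edot_sumr (I : finType) u (F : I -> 'rV[R]_d) :
  edot u (\sum_i F i) = \sum_i edot u (F i).
Proof.
rewrite /edot exchange_big; apply: eq_bigr => j _.
by rewrite summxE mulr_sumr.
Qed.

Lemma edotvv v : edot v v = enorm v ^+ 2.
Proof.
rewrite /enorm sqr_sqrtr; first by apply: eq_bigr => j _; rewrite expr2.
by apply: sumr_ge0 => j _; rewrite sqr_ge0.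
Qed.

Lemma enorm_ge0 v : 0 <= enorm v.
Proof. exact: sqrtr_ge0. Qed.

Lemma enormZ a v : enorm (a *: v) = `|a| * enorm v.
Proof.
apply/eqP; rewrite -(@eqrXn2 _ 2) ?mulr_ge0 ?enorm_ge0// exprMn -normrX.
by rewrite (ger0_norm (sqr_ge0 a)) -!edotvv edotZr edotC edotZr mulrA expr2.
Qed.

Lemma enormN v : enorm (- v) = enorm v.
Proof. by rewrite -scaleN1r enormZ normrN1 mul1r. Qed.

Lemma enorm_eq0 v : (enorm v == 0) = (v == 0).
Proof.
apply/eqP/eqP => [v0|->]; last by rewrite -(scale0r 0) enormZ normr0 mul0r.
have /eqP : edot v v = 0 by rewrite edotvv v0 expr0n.
rewrite psumr_eq0 => [/allP h|j _]; last by rewrite -expr2 sqr_ge0.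
apply/rowP => j; have := h j (mem_index_enum j).
by rewrite -expr2 sqrf_eq0 mxE => /eqP.
Qed.

(** Cauchy-Schwarz: with [a = enorm u] and [b = enorm v], the squared norm of [b *: u - a *: v]
    expands to [2ab(ab - edot u v)], and [2ab] can be cancelled unless [u] or [v] is zero. *)
Lemma edot_le u v : edot u v <= enorm u * enorm v.
Proof.
have [/eqP|u0] := eqVneq (enorm u) 0.
  rewrite enorm_eq0 => /eqP ->; rewrite /edot big1 ?mulr_ge0 ?enorm_ge0// => j _.
  by rewrite mxE mul0r.
have [/eqP|v0] := eqVneq (enorm v) 0.
  rewrite enorm_eq0 => /eqP ->; rewrite /edot big1 ?mulr_ge0 ?enorm_ge0// => j _.
  by rewrite mxE mulr0.
have up : 0 < enorm u by rewrite lt_neqAle eq_sym u0 enorm_ge0.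
have vp : 0 < enorm v by rewrite lt_neqAle eq_sym v0 enorm_ge0.
have : 0 <= edot (enorm v *: u - enorm u *: v) (enorm v *: u - enorm u *: v).
  by rewrite edotvv sqr_ge0.
rewrite edotBl !(edotC (_ *: _)) !edotZr !edotBl.
rewrite !(edotC (_ *: _)) !edotZr !edotvv (edotC v u).
set a := enorm u; set b := enorm v; set e := edot u v => h.
have : 0 <= 2 * (a * b) * (a * b - e) by nra.
by rewrite pmulr_rge0 ?subr_ge0// !mulr_gt0.
Qed.

End Euclidean.

(** * Quadratic upper bounds from Lipschitz gradients *)

Section Descent.
Variables (R : realType) (d : nat).
Implicit Types (g : 'rV[R]_d -> R) (x v : 'rV[R]_d) (K : R).

Definition quadratic_upper K g := forall x v,
  g (x + v) <= g x + edot (grad g x) v + K / 2 * enorm v ^+ 2.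

Lemma derive_grad g x v : differentiable g x -> 'D_v g x = edot (grad g x) v.
Proof.
move=> dg; rewrite deriveE// {1}[v]row_sum_delta linear_sum.
by apply: eq_bigr => j _; rewrite linearZ mxE deriveE// mulrC.
Qed.

Lemma is_derive_line g x v (t : R) : differentiable g (x + t *: v) ->
  is_derive t 1 (fun s : R => g (x + s *: v)) (edot (grad g (x + t *: v)) v).
Proof.
move=> dg.
(* The difference quotient along the line in direction 1 is that of [g] at [x + t *: v] in direction
   [v]. *)
have E : (fun h : R => h^-1 *: (g (x + (h *: 1 + t) *: v) - g (x + t *: v))) =
    (fun h : R => h^-1 *: (g (h *: v + (x + t *: v)) - g (x + t *: v))).
  apply/funext => h; congr (_ *: (g _ - _)).
  by rewrite [h *: 1]mulr1 scalerDl addrCA.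
apply: DeriveDef; first by rewrite /derivable /= E; exact: diff_derivable.
by rewrite -derive_grad// /derive/= E.
Qed.

Lemma smooth_quadratic_upper K g : smooth_with K g -> quadratic_upper K g.
Proof.
case=> dg Kg x v; set G := edot (grad g x) v; set N := enorm v ^+ 2.
pose psi (t : R) := g (x + t *: v) - (t * G + K / 2 * N * t ^+ 2).
have dpsi (t : R) : is_derive t 1 psi
    (edot (grad g (x + t *: v) - grad g x) v - K * N * t).
  have := is_derive_line (dg (x + t *: v)) => ?.
  apply: is_derive_eq; rewrite edotBl -/G !scaler1 /GRing.scale/=.
  by field.
have : psi 1 <= psi 0.
  apply: (@ler0_derive1_le_cc _ psi 0 1) => //.
  - move=> t; rewrite in_itv/= => /andP[t0 _].
    rewrite derive1E derive_val subr_le0.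
    apply: le_trans (edot_le _ _) _.
    have := Kg (x + t *: v) x.
    rewrite addrAC subrr add0r enormZ gtr0_norm// => h.
    apply: le_trans (ler_wpM2r (enorm_ge0 _) h) _.
    by rewrite /N expr2; lra.
  - apply: derivable_within_continuous => t _.
    exact: ex_derive.
  - by rewrite in_itv/= lexx ler01.
  - by rewrite in_itv/= lexx ler01.
rewrite /psi /= scale1r scale0r addr0 expr1n; lra.
Qed.

(** The displacement [- K^-1 *: grad g x] minimizes the quadratic upper bound at [x]; that minimum
    is still at least [m]. *)
Lemma quadratic_upper_grad_le K g (m : R) : 0 < K -> quadratic_upper K g ->
  (forall x, m <= g x) ->
  forall x, enorm (grad g x) ^+ 2 <= 2 * K * (g x - m).
Proof.
move=> K0 gK gm x.
have := le_trans (gm _) (gK x (- (K^-1 *: grad g x))).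
rewrite edotNr edotZr enormN enormZ edotvv gtr0_norm ?invr_gt0//.
set N := enorm _ => h.
have {}h : N ^+ 2 / (2 * K) <= g x - m.
  have -> : N ^+ 2 / (2 * K) =
    K^-1 * N ^+ 2 - K / 2 * (K^-1 * N) ^+ 2 by field; rewrite gt_eqF.
  lra.
by rewrite mulrC -ler_pdivrMr// mulr_gt0.
Qed.

End Descent.

Lemma smooth_with_le (R : realType) (d : nat) (g : 'rV[R]_d -> R) K K' :
  K <= K' -> smooth_with K g -> smooth_with K' g.
Proof.
move=> KK' [dg gK]; split=> // x y; apply: le_trans (gK x y) _.
by rewrite ler_wpM2r// enorm_ge0.
Qed.

Lemma smooth_with_lt0 (R : realType) (d : nat) (g : 'rV[R]_d -> R) K :
  K < 0 -> smooth_with K g -> forall x y : 'rV[R]_d, x = y.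
Proof.
move=> K0 [_ gK] x y; apply/eqP; rewrite -subr_eq0 -enorm_eq0.
rewrite eq_le enorm_ge0 andbT -(ler_nM2l K0) mulr0.
exact: le_trans (enorm_ge0 _) (gK x y).
Qed.

(** * Gradient and quadratic bound of the average *)

Section AverageObjective.
Variables (R : realType) (d n : nat) (f : 'I_n -> 'rV[R]_d -> R).
Hypothesis df : forall i x, differentiable (f i) x.

Lemma grad_favg x : grad (favg f) x = n%:R^-1 *: \sum_i grad (f i) x.
Proof.
have -> : favg f = n%:R^-1 *: (\sum_i f i) :> ('rV[R]_d -> R).
  by apply/funext => y; rewrite /favg fctE /GRing.scale/= fct_sumE.
apply/rowP => j; rewrite !mxE deriveZ; last first.
  by apply: derivable_sum => i; exact: diff_derivable.
rewrite derive_sum => [|i]; last exact: diff_derivable.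
by rewrite summxE; congr (_ * _); apply: eq_bigr => i _; rewrite mxE.
Qed.

Lemma quadratic_upper_favg K : (0 < n)%N ->
  (forall i, quadratic_upper K (f i)) -> quadratic_upper K (favg f).
Proof.
move=> n0 fK x v; have nR : n%:R != 0 :> R by rewrite pnatr_eq0 -lt0n.
rewrite grad_favg [edot _ v]edotC edotZr edot_sumr /favg -mulrDr -big_split/=.
rewrite -[K / 2 * _](mulKf nR) -mulrDr ler_wpM2l ?invr_ge0//.
rewrite -[n in n%:R * _]card_ord mulr_natl -sumr_const -big_split/=.
by apply: ler_sum => i _; rewrite [edot v _]edotC; exact: fK.
Qed.

End AverageObjective.

(** * One step of SGD with the bounded Polyak step-size *)

Section OneStep.
Variables (R : realType) (d : nat) (c gb K M : R).
Hypotheses (c0 : 0 < c) (gb0 : 0 < gb) (K0 : 0 <= K) (M0 : 0 < M).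
Let alpha := Num.min (1 / (2 * c * M)) gb.

Let alpha_gt0 : 0 < alpha.
Proof. by rewrite lt_min gb0 divr_gt0// !mulr_gt0. Qed.

(** The lower bound holds because [quadratic_upper_grad_le] keeps the Polyak quotient above
    [1 / (2 * c * M)]; the other two bounds come from the two arguments of the minimum. *)
Lemma sps_max_bounds (g : 'rV[R]_d -> R) (x : 'rV[R]_d) :
  quadratic_upper M g -> (forall y, fine (einf g) <= g y) ->
  let gam := sps_max c gb g x in
  [/\ alpha <= gam, gam <= gb &
      c * gam * enorm (grad g x) ^+ 2 <= g x - fine (einf g)].
Proof.
move=> gM gm /=; rewrite /sps_max; case: eqP => [->|/eqP G0].
  rewrite ge_min lexx orbT; split => //.
  have /eqP -> : enorm (0 : 'rV[R]_d) == 0 by rewrite enorm_eq0.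
  by rewrite expr0n mulr0 subr_ge0.
have Gp : 0 < c * enorm (grad g x) ^+ 2.
  by rewrite mulr_gt0// exprn_gt0// lt_neqAle enorm_ge0 eq_sym enorm_eq0 G0.
split; last 1 first.
- rewrite mulrAC mulrC -ler_pdivlMr//.
  by rewrite ge_min lexx.
- rewrite le_min ge_min [X in _ && X]ge_min lexx orbT andbT; apply/orP; left.
  rewrite ler_pdivrMr ?mulr_gt0// mulrAC ler_pdivlMr// mul1r.
  have := quadratic_upper_grad_le M0 gM gm x.
  by move=> /(ler_wpM2l (ltW c0)); lra.
- by rewrite ge_min lexx orbT.
Qed.

(* The descent inequality is divided by the step-size before the latter is
   replaced by its bounds, so that the gradient correlation term, whose sign is
   unknown, is multiplied by the deterministic factor [gb]. *)
Lemma sps_max_descent (F g : 'rV[R]_d -> R) (Fs : R) (x : 'rV[R]_d) :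
  quadratic_upper K F -> (forall y, Fs <= F y) ->
  quadratic_upper M g -> (forall y, fine (einf g) <= g y) ->
  F (x - sps_max c gb g x *: grad g x) - Fs <=
  gb * ((F x - Fs) / alpha - edot (grad F x) (grad g x)
        + K / (2 * c) * (g x - fine (einf g))).
Proof.
move=> FK Fmin gM gm; have [] := sps_max_bounds x gM gm.
set gam := sps_max _ _ _ _; set m := fine _ => ag gb_le Gle.
have gam0 : 0 < gam by exact: lt_le_trans ag.
set y := x - _; set Q := (X in gb * X).
have yQ : F y - Fs <= gam * Q.
  have := FK x (- (gam *: grad g x)).
  rewrite edotNr edotZr enormN enormZ gtr0_norm// -/y.
  have Fa : F x - Fs <= gam * ((F x - Fs) / alpha).
    rewrite mulrCA ler_peMr ?subr_ge0//.
    by rewrite ler_pdivlMr// mul1r.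
  have : K / 2 * (gam * enorm (grad g x)) ^+ 2 <=
         gam * (K / (2 * c) * (g x - m)).
    have -> : K / 2 * (gam * enorm (grad g x)) ^+ 2 =
      gam * (K / (2 * c) * (c * gam * enorm (grad g x) ^+ 2)).
      by field; rewrite gt_eqF.
    by rewrite ler_pM2l// ler_wpM2l// divr_ge0// mulr_ge0// ltW.
  by rewrite /Q; lra.
(* Replacing [gam] by [gb] requires [0 <= Q], which follows from [0 <= F y - Fs <= gam * Q] since
   [Fs] is a lower bound of [F]. *)
apply: (le_trans yQ); rewrite ler_wpM2r// -(pmulr_rge0 _ gam0).
by apply: (le_trans _ yQ); rewrite subr_ge0.
Qed.

Lemma sps_max_average_descent (n : nat) (f : 'I_n -> 'rV[R]_d -> R)
    (xs x : 'rV[R]_d) (mu : R) : (0 < n)%N -> K <= M ->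
  (forall i y, differentiable (f i) y) ->
  (forall i, quadratic_upper M (f i)) ->
  (forall i y, fine (einf (f i)) <= f i y) ->
  quadratic_upper K (favg f) -> (forall y, favg f xs <= favg f y) ->
  PL mu (favg f) xs ->
  n%:R^-1 * \sum_i
    (favg f (x - sps_max c gb (f i) x *: grad (f i) x) - favg f xs) <=
  gb * (1 / alpha - 2 * mu + M / (2 * c)) * (favg f x - favg f xs) +
  gb * K / (2 * c) * (n%:R^-1 * \sum_i (f i xs - fine (einf (f i)))).
Proof.
move=> n0 KM df fM fm FK Fmin FPL.
have nR : 0 < n%:R :> R by rewrite ltr0n.
set F := favg f; set s := n%:R^-1 * \sum_i (f i xs - _).
pose Q i := (F x - F xs) / alpha - edot (grad F x) (grad (f i) x)
            + K / (2 * c) * (f i x - fine (einf (f i))).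
have : n%:R^-1 * \sum_i
    (F (x - sps_max c gb (f i) x *: grad (f i) x) - F xs) <=
    n%:R^-1 * \sum_i gb * Q i.
  apply: ler_wpM2l; first by rewrite invr_ge0 ltW.
  by apply: ler_sum => i _; exact: sps_max_descent.
move/le_trans; apply.
(* The mean of [f i x - inf (f i)] splits into the gap [F x - F xs] and the noise [s]. *)
have -> : n%:R^-1 * \sum_i gb * Q i = gb * ((F x - F xs) / alpha
    - enorm (grad F x) ^+ 2 + K / (2 * c) * (F x - F xs + s)).
  rewrite -mulr_sumr mulrCA; congr (gb * _).
  rewrite /Q !big_split/= sumrN sumr_const card_ord -mulr_sumr -edot_sumr.
  rewrite -edotvv {3}[grad F x]grad_favg// edotZr /s /F /favg !sumrB -mulr_natl.
  by field; rewrite !gt_eqF.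
have h1 := FPL x; have h2 : 0 <= F x - F xs by rewrite subr_ge0.
have h3 : K / (2 * c) * (F x - F xs) <= M / (2 * c) * (F x - F xs).
  by rewrite ler_wpM2r// ler_wpM2r// invr_ge0 mulr_ge0// ltW.
have -> : gb * K / (2 * c) * s = gb * (K / (2 * c) * s) by rewrite !mulrA.
rewrite -(mulrA gb) -mulrDr; apply: ler_wpM2l; first exact: ltW.
by move: h1 h3; rewrite -/F; lra.
Qed.

End OneStep.

(** * Expectations over random index paths *)

Section IndexPath.
Variables (disp : measure_display) (T : measurableType disp) (R : realType).
Variables (P : probability T R) (n : nat) (idx : nat -> T -> 'I_n).
Hypotheses (unif : forall k, uniform_index P (idx k)).
Hypotheses (indep : mutually_independent P idx).

Lemma expectation_index_path k (G : k.-tuple 'I_n -> R) :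
  (forall t, 0 <= G t) ->
  ('E_P[fun w => G [tuple idx j w | j < k]] =
   (n%:R ^- k * \sum_t G t)%:E)%E.
Proof.
(* [A t] is the event that the first [k] draws spell [t]; these events partition the space. The
   default of [nth] is [i] itself, so no element of ['I_n] has to be supplied, and it is never
   reached for [j < k]. *)
move=> G0; pose A (t : k.-tuple _) := \bigcap_(j in [set` iota 0 k])
  (idx j @^-1` [set i | i = nth i t j]).
have inA t w : A t w <-> t = [tuple idx j w | j < k].
  split => [Aw|->].
    apply: eq_from_tnth => j; rewrite tnth_mktuple (tnth_nth (idx j w)).
    by symmetry; apply: Aw; rewrite /= mem_iota/= add0n ltn_ord.
  move=> j /=; rewrite mem_iota/= add0n => jk.
  have := tnth_nth (idx j w) [tuple idx j w | j < k] (Ordinal jk).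
  by rewrite tnth_mktuple.
have Ej j (t : k.-tuple 'I_n) : (j < k)%N ->
    exists i, [set i | i = nth i t j] = [set i].
  move=> jk; exists (tnth t (Ordinal jk)); apply/seteqP; split => i /=.
    by move=> ->; rewrite (tnth_nth i).
  by rewrite (tnth_nth i).
have mA t : measurable (A t).
  apply: fin_bigcap_measurable; first exact: finite_seq.
  move=> j /=; rewrite mem_iota/= add0n => /(Ej _ t)[i ->].
  by have [] := unif j i.
have PA t : P (A t) = (n%:R ^- k)%:E.
  rewrite indep ?iota_uniq//.
  rewrite (eq_big_seq (fun=> (n%:R^-1)%:E)).
    rewrite big_const_seq count_predT size_iota.
    elim: k {G G0 A inA Ej mA t} => [|k IH]; first by rewrite expr0 invr1.
    by rewrite iterS IH -EFinM exprS invfM.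
  move=> j; rewrite mem_iota/= add0n => /(Ej _ t)[i ->].
  by have [] := unif j i.
rewrite unlock.
(* At each [w] only the term of the path actually drawn survives. *)
transitivity (\int[P]_w (\sum_t (G t)%:E * (\1_(A t) w)%:E))%E.
  apply: eq_integral => w _.
  rewrite (bigD1 [tuple idx j w | j < k])//= big1 => [|t tw].
    by rewrite adde0 indicE mem_set ?mule1//; exact/inA.
  rewrite indicE memNset ?mule0//.
  by move/inA => E; rewrite E eqxx in tw.
rewrite ge0_integral_sum//; last 2 first.
- move=> t; apply/measurable_funeM/measurable_realfun.measurable_EFinP.
  exact: measurable_realfun.measurable_indic.
- by move=> t w _; rewrite mule_ge0// lee_fin.
rewrite mulr_sumr -sumEFin; apply: eq_bigr => t _.
rewrite ge0_integralZl_EFin//; last first.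
  apply/measurable_realfun.measurable_EFinP.
  exact: measurable_realfun.measurable_indic.
rewrite integral_indic// setIT [_ ^- k * _]mulrC EFinM.
by congr (_ * _)%E; exact: PA.
Qed.

End IndexPath.

(** * Path sums, affine recursions and finiteness of the infima *)

Lemma sum_tuple_rcons (V : nmodType) (I : finType) k
    (F : k.+1.-tuple I -> V) :
  \sum_t F t = \sum_(t : k.-tuple I) \sum_i F [tuple of rcons t i].
Proof.
rewrite pair_bigA/=.
rewrite (reindex (fun p : k.-tuple I * I => [tuple of rcons p.1 p.2])) //=.
exists (fun t => ([tuple of belast (thead t) (behead t)],
                  last (thead t) (behead t))).
  case=> [t i] _; congr pair => /=.
    apply/val_inj => /=; case: t => -[|x s] //= ?.
    by rewrite belast_rcons.
  by case: t => -[|x s] //= ?; rewrite /thead /= last_rcons.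
move=> t _; apply/val_inj => /=; case/tupleP: t => x s.
by rewrite theadE/= -lastI.
Qed.

Lemma sgd_ext (R : realType) (d n : nat) (f : 'I_n -> 'rV[R]_d -> R)
    (c gb : R) (x0 : 'rV[R]_d) (a b : nat -> 'I_n) k :
  (forall j, (j < k)%N -> a j = b j) -> sgd f c gb x0 a k = sgd f c gb x0 b k.
Proof.
elim: k => //= k IH ab; rewrite ab// IH// => j jk.
by apply: ab; rewrite ltnS ltnW.
Qed.

(** [C] is any nonnegative number not increased by [t -> nu * t + B], rather than [B / (1 - nu)], so
    that [nu = 1] with [B = 0] is covered by [C = 0]. *)
Lemma affine_recursion_le (R : realType) (nu B C : R) (u : nat -> R) :
  0 <= nu -> 0 <= C -> nu * C + B <= C ->
  (forall k, u k.+1 <= nu * u k + B) ->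
  forall k, u k <= nu ^+ k * u 0%N + C.
Proof.
move=> nu0 C0 hC hu; elim=> [|k IH]; first by rewrite expr0 mul1r lerDl.
have := ler_wpM2l nu0 IH; rewrite exprS; have := hu k; lra.
Qed.

Lemma einf_le (R : realType) (d : nat) (g : 'rV[R]_d -> R) y :
  (einf g <= (g y)%:E)%E.
Proof. by apply: ereal_inf_lbound; exists y. Qed.

Lemma fine_einf_le (R : realType) (d : nat) (g : 'rV[R]_d -> R) y :
  einf g \is a fin_num -> fine (einf g) <= g y.
Proof. by move=> gfin; rewrite -lee_fin fineK// einf_le. Qed.

Lemma sigma2_fin_num (R : realType) (d n : nat) (f : 'I_n -> 'rV[R]_d -> R)
    (xs : 'rV[R]_d) : (0 < n)%N -> sigma2 f xs \is a fin_num ->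
  forall i, einf (f i) \is a fin_num.
Proof.
move=> n0; rewrite /sigma2; set S := (\sum_i _)%E => Sfin i.
have ninv : 0 < n%:R^-1 :> R by rewrite invr_gt0 ltr0n.
have : S \is a fin_num.
  (* An infinite sum would stay infinite after multiplication by the positive [n%:R^-1]. *)
  by case: S Sfin => [r||]//; rewrite (mulry, mulrNy) gtr0_sg// mul1e.
move/sum_fin_numP => /(_ i (mem_index_enum i) isT).
by rewrite fin_numB => /andP[].
Qed.

Lemma sigma2E (R : realType) (d n : nat) (f : 'I_n -> 'rV[R]_d -> R)
    (xs : 'rV[R]_d) : (forall i, einf (f i) \is a fin_num) ->
  sigma2 f xs = (n%:R^-1 * \sum_i (f i xs - fine (einf (f i))))%:E.
Proof.
move=> ffin; rewrite /sigma2 EFinM -sumEFin; congr (_ * _)%E.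
by apply: eq_bigr => i _; rewrite EFinB fineK.
Qed.

(** * Mean optimality gap along the iterates *)

Section Iterates.
Variables (R : realType) (d n : nat) (f : 'I_n -> 'rV[R]_d -> R).
Variables (c gb : R) (x0 : 'rV[R]_d) (i0 : 'I_n) (Phi : 'rV[R]_d -> R).

(** [i0] only pads the path beyond its [k] entries, which [sgd] at step [k] never reads. *)
Definition sgd_mean k : R :=
  n%:R ^- k * \sum_(t : k.-tuple 'I_n) Phi (sgd f c gb x0 (nth i0 t) k).

Lemma sgd_mean0 : sgd_mean 0 = Phi x0.
Proof. by rewrite /sgd_mean/= sumr_const card_tuple expn0 expr0 invr1 mul1r. Qed.

(** Paths are split at their last entry because [sgd] applies draw [k] last; the first [k] entries
    determine the iterate before it. *)
Lemma sgd_meanS k : sgd_mean k.+1 = n%:R ^- k * \sum_(t : k.-tuple 'I_n)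
  let x := sgd f c gb x0 (nth i0 t) k in
  n%:R^-1 * \sum_i Phi (x - sps_max c gb (f i) x *: grad (f i) x).
Proof.
rewrite /sgd_mean sum_tuple_rcons -mulr_sumr mulrA exprSr invfM.
congr (_ * _); apply: eq_bigr => t _; apply: eq_bigr => i _ /=.
rewrite nth_rcons size_tuple ltnn eqxx.
rewrite (@sgd_ext _ _ _ f c gb x0 _ (nth i0 t))// => j jk.
by rewrite nth_rcons size_tuple jk.
Qed.

Lemma sgd_mean_le nu B k :
  (forall x, n%:R^-1 *
     \sum_i Phi (x - sps_max c gb (f i) x *: grad (f i) x) <= nu * Phi x + B) ->
  sgd_mean k.+1 <= nu * sgd_mean k + B.
Proof.
move=> step; have nR : n%:R != 0 :> R by rewrite pnatr_eq0; case: n i0 => [[]|].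
rewrite sgd_meanS /sgd_mean mulrCA [nu * _]mulr_sumr.
rewrite -[B](mulKf (expf_neq0 k nR)) -mulrDr ler_wpM2l ?invr_ge0 ?exprn_ge0//.
have -> : n%:R ^+ k * B = \sum_(t : k.-tuple 'I_n) B.
  by rewrite sumr_const card_tuple card_ord -natrX mulr_natl.
by rewrite -big_split/=; apply: ler_sum => t _; exact: step.
Qed.

Lemma expectation_sgd (disp : measure_display) (T : measurableType disp)
    (P : probability T R) (idx : nat -> T -> 'I_n) k :
  (forall k, uniform_index P (idx k)) -> mutually_independent P idx ->
  (forall x, 0 <= Phi x) ->
  ('E_P[fun w => Phi (sgd f c gb x0 (idx ^~ w) k)] = (sgd_mean k)%:E)%E.
Proof.
move=> unif indep Phi0; rewrite -(expectation_index_path unif indep)//.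
congr ('E_P[_])%E; apply/funext => w; congr Phi; apply: sgd_ext => j jk.
have := tnth_nth i0 [tuple idx j w | j < k] (Ordinal jk).
by rewrite tnth_mktuple.
Qed.

End Iterates.

(** * The convergence bound, with its degenerate constants *)

Theorem theorem3p6 (R : realType) (d n : nat) (hn : (0 < n)%N)
  (f : 'I_n -> 'rV[R]_d -> R) (xs : 'rV[R]_d)
  (hmin : forall x, favg f xs <= favg f x)
  (hsigma : sigma2 f xs \is a fin_num)
  (mu : R) (hmu : 0 < mu) (hPL : PL mu (favg f) xs)
  (L : R) (Li : 'I_n -> R)
  (hL : smooth_with L (favg f))
  (hLi : forall i, smooth_with (Li i) (f i))
  (disp : measure_display) (T : measurableType disp) (P : probability T R)
  (idx : nat -> T -> 'I_n)
  (hunif : forall k, uniform_index P (idx k))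
  (hindep : mutually_independent P idx)
  (c gb : R) (hc0 : 0 < c) (hgb0 : 0 < gb) (x0 : 'rV[R]_d) :
  let Lmax := \big[Num.max/0]_(i < n) Li i in
  let alpha := Num.min (1 / (2 * c * Lmax)) gb in
  let nu := gb * (1 / alpha - 2 * mu + Lmax / (2 * c)) in
  Lmax / (4 * mu) < c ->
  1 / (2 * c * Lmax) <= gb ->
  0 < nu -> nu <= 1 ->
  forall k : nat,
    ('E_P[fun w => (favg f (sgd f c gb x0 (idx ^~ w) k) - favg f xs)%R]
     <= (nu ^+ k * (favg f x0 - favg f xs))%:E
        + L%:E * sigma2 f xs * gb%:E / (2 * (1 - nu) * c)%:E)%E.
Proof.
move=> Lmax alpha nu _ _ nu_gt0 nu_le1 k.
have ffin := sigma2_fin_num hn hsigma.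
rewrite (sigma2E xs ffin).
set s := n%:R^-1 * \sum_i (f i xs - fine (einf (f i))).
have n0 : 0 <= n%:R^-1 :> R by rewrite invr_ge0.
have s0 : 0 <= s.
  by rewrite mulr_ge0// sumr_ge0// => i _; rewrite subr_ge0 fine_einf_le.
have LiM i : Li i <= Lmax by rewrite /Lmax; exact: le_bigmax.
have Lmax_ge0 : 0 <= Lmax by exact: bigmax_ge_id.
have Lmax_gt0 : 0 < Lmax.
  (* With inverses of 0 equal to 0, [Lmax = 0] would give [alpha = 0] and
     [nu = - 2 * mu * gb < 0]. *)
  rewrite lt_neqAle Lmax_ge0 andbT; apply/eqP => Lmax0.
  move: nu_gt0; rewrite /nu /alpha -Lmax0 !(mulr0, mul0r, invr0, addr0).
  rewrite min_l ?ltW// invr0 mulr0 add0r; have := mulr_gt0 hgb0 hmu; lra.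
have fM i : quadratic_upper Lmax (f i).
  exact/smooth_quadratic_upper/(smooth_with_le (LiM i)).
have df i y : differentiable (f i) y by case: (hLi i).
(* The maximum with 0 keeps [K] nonnegative for negative [L], as the one-step bound requires. *)
pose K := Num.min (Num.max L 0) Lmax.
have FK : quadratic_upper K (favg f).
  rewrite /K; case: (leP _ Lmax) => _; last exact: (quadratic_upper_favg df hn fM).
  by apply/smooth_quadratic_upper/(smooth_with_le _ hL); rewrite le_max lexx.
have K0 : 0 <= K by rewrite le_min le_max lexx orbT.
have KLmax : K <= Lmax by rewrite ge_min lexx orbT.
have Ls : K * s <= L * s /\ 0 <= L * s.
  have [L_lt0|L_ge0] := ltP L 0.
    suff -> : s = 0 by rewrite !mulr0.
    rewrite /s big1 ?mulr0// => i _; apply/eqP; rewrite subr_eq0 eq_le.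
    rewrite fine_einf_le// andbT -lee_fin fineK//.
    apply: le_ereal_inf_tmp => _ [y _ <-].
    by rewrite (smooth_with_lt0 L_lt0 hL y xs).
  by rewrite mulr_ge0// ler_wpM2r// /K max_l// ge_min lexx.
case: Ls => KLs Ls0.
pose Phi x := favg f x - favg f xs.
have Phi0 x : 0 <= Phi x by rewrite subr_ge0.
rewrite (@expectation_sgd _ _ _ f c gb x0 (Ordinal hn) Phi)//.
have step x : n%:R^-1 *
    \sum_i Phi (x - sps_max c gb (f i) x *: grad (f i) x) <=
    nu * Phi x + gb / (2 * c) * (L * s).
  have fe i y : fine (einf (f i)) <= f i y by exact: fine_einf_le.
  have := sps_max_average_descent hc0 hgb0 K0 Lmax_gt0 x hn KLmax df fM fe
    FK hmin hPL.
  move=> /le_trans; apply.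
  rewrite lerD2l -/s (mulrAC gb) -[leLHS]mulrA; apply: ler_wpM2l => //.
  by rewrite divr_ge0 ?mulr_ge0 ?ltW.
have bound C : 0 <= C -> nu * C + gb / (2 * c) * (L * s) <= C ->
    sgd_mean f c gb x0 (Ordinal hn) Phi k <= nu ^+ k * Phi x0 + C.
  move=> C0 hC; rewrite -(sgd_mean0 f c gb x0 (Ordinal hn) Phi).
  apply: (affine_recursion_le (ltW nu_gt0) C0 hC) => j.
  exact: sgd_mean_le.
rewrite -!EFinM inver; case: eqP => [_|/eqP nz].
  (* Here [nu = 1]. Without noise [C = 0] is admissible; otherwise the right-hand side is
     infinite. *)
  have [Ls_eq0|Ls_neq0] := eqVneq (L * s) 0.
    rewrite Ls_eq0 mul0r mul0e adde0 lee_fin -[leRHS]addr0; apply: bound => //.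
    by rewrite Ls_eq0 !mulr0 addr0.
  rewrite gt0_muley ?addey ?leey// lte_fin mulr_gt0//.
  by rewrite lt_neqAle eq_sym Ls_neq0.
rewrite -EFinM -EFinD lee_fin; apply: bound.
  apply: divr_ge0; first by rewrite mulr_ge0// ltW.
  by rewrite !mulr_ge0 ?subr_ge0// ltW.
(* For [nu < 1] the noise term is exactly the fixed point of the affine recursion. *)
rewrite le_eqVlt; apply/orP; left; apply/eqP; field.
by move: nz; rewrite !mulf_eq0 !negb_or => /andP[/andP[_ ->] ->].
Qed.
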